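(* Let $\phi_1:(0,\infty)\to(0,\infty)$ be a measurable function, let $Z_1=S_2/S_1$, and consider the estimator $\delta_{\phi_1}=\phi_1(Z_1)S_1$ of $\sigma_1^2$. Put $$\phi_{11}^{Q}(z_1)=\frac{(1+z_1)\,E(\tau^{-1})}{(m_1+m_2+2)\,E(\tau^{-2})}.$$ If $P\left(\phi_{11}^{Q}(Z_1)<\phi_1(Z_1)\right)>0$, then under the squared error loss $L_1$ the risk of the estimator $$\delta_{S1}^{Q}=\min\left\{\phi_1(Z_1),\phi_{11}^{Q}(Z_1)\right\}S_1$$ is nowhere larger than the risk of $\delta_{\phi_1}$; that is, $R(\delta_{S1}^Q)\le R(\delta_{\phi_1})$ for all parameter values with $\sigma_1\le\sigma_2$.
   Context: Model: $p,q,m_1,m_2$ are positive integers; $\tau$ is a positive random variable (mixing variable) with known distribution $\Pi$ on $(0,\infty)$, such that the moments $E(\tau^{-1})$ and $E(\tau^{-2})$ are finite. Conditionally on $\tau$, the variables $\boldsymbol X_1,S_1,\boldsymbol X_2,S_2$ are independent with $\boldsymbol X_1\sim N_p(\boldsymbol\theta_1,\frac{\sigma_1^2}{\tau}I)$, $S_1\sim\frac{\sigma_1^2}{\tau}\chi^2_{m_1}$, $\boldsymbol X_2\sim N_q(\boldsymbol\theta_2,\frac{\sigma_2^2}{\tau}I)$, $S_2\sim\frac{\sigma_2^2}{\tau}\chi^2_{m_2}$ (the same $\tau$ for all four). The unknown parameters are $\boldsymbol\theta_1\in\mathbb R^p$, $\boldsymbol\theta_2\in\mathbb R^q$, $\sigma_1,\sigma_2>0$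 with the order restriction $\sigma_1\le\sigma_2$. The squared error loss for estimating $\sigma^2$ by $\delta$ is $L_1(\delta,\sigma^2)=(\delta/\sigma^2-1)^2$; the risk of an estimator $\delta$ of $\sigma_1^2$ is $R(\delta)=E[L_1(\delta,\sigma_1^2)]$, a function of the parameters. *)

(* Defs.v *)
From HB Require Import structures.
From mathcomp Require Import all_boot all_order all_algebra.
From mathcomp Require Import all_classical all_reals all_analysis.

Set Implicit Arguments.
Unset Strict Implicit.
Unset Printing Implicit Defensive.

Import Order.TTheory GRing.Theory Num.Theory.
Import numFieldNormedType.Exports.

Local Open Scope classical_set_scope.
Local Open Scope ring_scope.

Section isotropic_normal.
Variable R : realType.

(* measurableTypeR R is R with the Borel sigma-algebra as carried by
   lebesgue_measure and normal_prob; the measurable sets are those of R. *)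
Definition cons_pair (n : nat) (xy : measurableTypeR R * n.-tuple R) :
    n.+1.-tuple R :=
  [tuple of (xy.1 : R) :: xy.2].

Lemma measurable_cons_pair (n : nat) :
  measurable_fun [set: measurableTypeR R * n.-tuple R] (@cons_pair n).
Proof.
apply: (@measurable_cons _ _ _ R fst n snd); last exact: measurable_snd.
exact: (@measurable_fst _ _ (measurableTypeR R) (n.-tuple R)).
Qed.

HB.instance Definition _ (n : nat) :=
  isMeasurableFun.Build _ _ _ _ (@cons_pair n) (@measurable_cons_pair n).

(* N_n(th, v I): the product of the N(th_i, v), transported from the nested
   product R * (R * ...) to n.-tuple R.  normal_prob takes the standard
   deviation, hence the square root. *)
Fixpoint normal_vec (n : nat) (v : R) :
    n.-tuple R -> probability (n.-tuple R) R :=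
  match n with
  | 0 => fun=> \d_([tuple] : 0.-tuple R)
  | n'.+1 => fun th =>
      distribution
        (normal_prob (thead th) (Num.sqrt v) \x
           normal_vec v ([tuple of behead th] : n'.-tuple R))%E
        (@cons_pair n')
  end.

End isotropic_normal.

Section chi_squared.
Variable R : realType.
Notation mu := (@lebesgue_measure R).

Definition Gamma (a : R) : R :=
  \int[mu]_(x in `]0, +oo[) (x `^ (a - 1) * expR (- x)).

Definition chi2_pdf (m : nat) : R -> R :=
  (fun x => x `^ (m%:R / 2 - 1) * expR (- x / 2)
            / (2 `^ (m%:R / 2) * Gamma (m%:R / 2))) \_ `]0, +oo[.

Definition chi2_prob (m : nat) (A : set R) : \bar R :=
  (\int[mu]_(x in A) (chi2_pdf m x)%:E)%E.

(* the law of c * K for K ~ chi^2_m *)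
Definition scaled_chi2_prob (m : nat) (c : R) (A : set R) : \bar R :=
  chi2_prob m ((fun x => c * x) @^-1` A).

End chi_squared.

Section model.
Variables (R : realType) (d : measure_display) (T : measurableType d).

(* The mixing variable tau has law Pi and, given tau = t, the variables
   X1, S1, X2, S2 are independent with the prescribed laws: the product of
   these laws is a regular conditional distribution of (X1, S1, X2, S2)
   given tau. *)
Definition normal_scale_mixture (P : probability T R) (Pi : probability (measurableTypeR R) R)
    (p q m1 m2 : nat) (theta1 : p.-tuple R) (theta2 : q.-tuple R)
    (sigma1 sigma2 : R) (tau : {RV P >-> R})
    (X1 : {RV P >-> p.-tuple R}) (S1 : {RV P >-> R})
    (X2 : {RV P >-> q.-tuple R}) (S2 : {RV P >-> R}) : Prop :=
  (forall B : set R, measurable B -> distribution P tau B = Pi B) /\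
  (forall (B : set R) (A1 : set (p.-tuple R)) (C1 : set R)
          (A2 : set (q.-tuple R)) (C2 : set R),
    measurable B -> measurable A1 -> measurable C1 ->
    measurable A2 -> measurable C2 ->
    P [set w | [/\ B (tau w), A1 (X1 w), C1 (S1 w), A2 (X2 w) & C2 (S2 w)]] =
    (\int[Pi]_(t in B `&` `]0%R, +oo[)
       (normal_vec (sigma1 ^+ 2 / t) theta1 A1 *
        scaled_chi2_prob m1 (sigma1 ^+ 2 / t) C1 *
        normal_vec (sigma2 ^+ 2 / t) theta2 A2 *
        scaled_chi2_prob m2 (sigma2 ^+ 2 / t) C2))%E).

Definition L1 (delta sigma_sq : R) : R := (delta / sigma_sq - 1) ^+ 2.

(* \bar R-valued: the risk of an estimator may be infinite *)
Definition risk (P : probability T R) (sigma_sq : R) (delta : T -> R) :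
    \bar R :=
  ('E_P[fun w => L1 (delta w) sigma_sq])%E.

(* phi is a function on (0, +oo); it is extended by 0 outside, where S2 / S1
   falls with probability 0 only. *)
Definition ratio_estimator (phi : R -> R) (S1 S2 : T -> R) : T -> R :=
  fun w => (phi \_ `]0, +oo[) (S2 w / S1 w) * S1 w.

End model.

Definition inv_moment (R : realType) (Pi : probability (measurableTypeR R) R) (k : nat) : R :=
  fine ('E_Pi[fun t : R => t ^- k])%E.

Definition phiQ11 (R : realType) (Pi : probability (measurableTypeR R) R) (m1 m2 : nat)
    (z : R) : R :=
  (1 + z) * inv_moment Pi 1 / ((m1 + m2 + 2)%:R * inv_moment Pi 2).

(* Main.v *)
Require Import Defs.
From HB Require Import structures.
From mathcomp Require Import all_boot all_order all_algebra.
From mathcomp Require Import all_classical all_reals all_analysis.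
From mathcomp Require Import measurable_realfun.
From mathcomp Require Import ring lra.

Set Implicit Arguments.
Unset Strict Implicit.
Unset Printing Implicit Defensive.
Import Order.TTheory GRing.Theory Num.Theory.
Import numFieldNormedType.Exports.

Local Open Scope classical_set_scope.
Local Open Scope ring_scope.

(* With S = S1 / sigma1^2, psi = phiQ11 and g = 2 (phi1 - psi)^+, completing the
   square gives  L1(min) + g psi S^2 <= L1(phi1) + g |S|  pointwise, so it
   suffices that  E[g(Z) |S|] <= E[g(Z) psi(Z) S^2].  By homogeneity the mixing
   variable factors out of both sides as E(tau^-1) and E(tau^-2), and what is
   left is an inequality between two chi-square integrals.  In the coordinates
   x and w = y / x these are integrals over w of Gamma integrals in x, compared
   for each w by Gamma(a + 1) = a Gamma(a); sigma1 <= sigma2 enters through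
   w <= (sigma2^2 / sigma1^2) w. *)

(** Given Z = S2 / S1, the risk is a convex quadratic in the value of [phi1], with minimiser E(S |
    Z) / E(S^2 | Z). Given w = y / x, the variable x is Gamma with shape (m1 + m2) / 2 and rate (1 +
    w) / 2, and w = Z / rho with rho = sigma2^2 / sigma1^2, so this minimiser is [phiQ11] at Z /
    rho. It is at most [phiQ11] at Z, with equality when sigma1 = sigma2, and lowering [phi1] to
    [phiQ11] moves towards it. No conditioning on Z is carried out: the weight g turns the
    comparison of minimisers into one between two plain expectations. The integrands compared are
    nonnegative and extended-real valued, so Tonelli applies without integrability checks. This is
    why |S| stands on one side: [S1] is nonnegative only almost surely. The one subtraction, of
    E[g(Z) |S|], requires finiteness; it follows from g(Z) |S| <= 3 + L1(phi1) when the risk of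
    [phi1] is finite, and an infinite risk leaves nothing to prove. *)

Lemma measurable_inv (R : realType) :
  measurable_fun [set: R] (fun x : R => x^-1).
Proof.
(* Squaring puts the base of the real power where [powR_inv1] applies; the factor x makes both sides
   0 at x = 0. *)
rewrite (_ : (fun x : R => x^-1) = (fun x => x * (x ^+ 2) `^ (-1))).
  apply: measurable_funM => //.
  apply: (measurableT_comp (measurable_powR _)).
  exact: exprn_measurable.
apply/funext => x; rewrite powR_inv1 ?sqr_ge0//.
have [->|x0] := eqVneq x 0; first by rewrite invr0 mul0r.
by field.
Qed.

Lemma measurable_fun_div d (T : measurableType d) (R : realType)
    (f g : T -> R) :
  measurable_fun setT f -> measurable_fun setT g ->
  measurable_fun setT (fun x => f x / g x).
Proof.
move=> mf mg; apply: measurable_funM => //.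
by apply: measurableT_comp mg; exact: measurable_inv.
Qed.

(** * Measures given by a density *)

Section density.
Local Open Scope ereal_scope.
Context d (T : measurableType d) (R : realType).
Variables (mu : {measure set T -> \bar R}) (g : T -> R).
Hypotheses (g0 : forall x, (0 <= g x)%R) (mg : measurable_fun setT g).

Let nu A := \int[mu]_(x in A) (g x)%:E.

Let nu0 : nu set0 = 0.
Proof. by rewrite /nu integral_set0. Qed.

Let nu_ge0 A : 0 <= nu A.
Proof. by apply: integral_ge0 => x _; rewrite lee_fin. Qed.

Let mEg D : measurable_fun D (EFin \o g).
Proof. by apply: measurable_funTS; exact/measurable_EFinP. Qed.

Let nu_sigma_additive : semi_sigma_additive nu.
Proof.
move=> /= F mF tF mUF; rewrite /nu; apply: cvg_toP.
  apply: ereal_nondecreasing_is_cvgn => m n mn.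
  by apply: lee_sum_nneg_natr => // k _ _; exact: nu_ge0.
by rewrite ge0_integral_bigcup//= => x _; rewrite lee_fin.
Qed.

HB.instance Definition _ := isMeasure.Build _ _ _ nu
  nu0 nu_ge0 nu_sigma_additive.

Import HBNNSimple.

(** Both sides commute with increasing limits, which reduces [f] to simple functions and then, by
    linearity, to indicators, where the claim is the definition of [nu]. *)
Let integral_nu (f : T -> \bar R) :
    (forall x, 0 <= f x) -> measurable_fun setT f ->
  \int[nu]_x f x = \int[mu]_x (f x * (g x)%:E).
Proof.
move=> f0 mf; pose h := nnsfun_approx measurableT mf.
have -> : \int[nu]_x f x = limn (fun n => \int[nu]_x (h n x)%:E).
  rewrite -monotone_convergence//.
  - apply: eq_integral => x _; apply/esym/cvg_lim => //.
    exact: cvg_nnsfun_approx.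
  - by move=> n; exact/measurable_EFinP.
  - by move=> n x _; rewrite lee_fin.
  - by move=> x _ a b ab; rewrite lee_fin; exact/lefP/nd_nnsfun_approx.
have -> : \int[mu]_x (f x * (g x)%:E) =
    limn (fun n => \int[mu]_x ((h n x)%:E * (g x)%:E)).
  rewrite -monotone_convergence//.
  - apply: eq_integral => x _; apply/esym/cvg_lim => //.
    by apply: cvgeZr => //; exact: cvg_nnsfun_approx.
  - by move=> n; apply: emeasurable_funM; exact/measurable_EFinP.
  - by move=> n x _; rewrite mule_ge0// lee_fin.
  - move=> x _ a b ab; rewrite lee_wpmul2r ?lee_fin//.
    exact/lefP/nd_nnsfun_approx.
congr (limn _); apply/funext => n.
under [LHS]eq_integral do rewrite fimfunE -fsumEFin//.
have indich r : measurable_fun setT (fun x => (r * \1_(h n @^-1` [set r]) x)%:E).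
  by apply/measurable_EFinP; exact: measurable_funM.
rewrite ge0_integral_fsum//; last by move=> m y _; exact: nnfun_muleindic_ge0.
transitivity (\int[mu]_x (\sum_(y \in range (h n))
    (y * \1_(h n @^-1` [set y]) x)%:E * (g x)%:E)); last first.
  apply: eq_integral => x _.
  by rewrite -ge0_mule_fsuml => [|y]; [rewrite fsumEFin// -(fimfunE _ x)
    | exact: nnfun_muleindic_ge0].
rewrite ge0_integral_fsum//; last 2 first.
  - by move=> y; apply: emeasurable_funM => //; exact: mEg.
  - by move=> m y _; rewrite mule_ge0 ?lee_fin//; exact: nnfun_muleindic_ge0.
apply: eq_fsbigr => r rhn.
have r0 : (0 <= r)%R by move: rhn; rewrite inE => -[t _ <-].
under eq_integral do rewrite EFinM.
rewrite integralZl_indic_nnsfun => //.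
under [RHS]eq_integral do rewrite EFinM -muleA.
rewrite ge0_integralZl//.
- congr (_ * _); rewrite integral_indic// setIT /= /nu.
  rewrite integral_mkcond; apply: eq_integral => x _.
  by rewrite epatch_indic muleC.
- by apply: emeasurable_funM => //; exact/measurable_EFinP.
- by move=> t _; rewrite mule_ge0 ?lee_fin.
Qed.

Lemma measure_of_density :
  exists nu : {measure set T -> \bar R},
    forall f, (forall x, 0 <= f x) -> measurable_fun setT f ->
      \int[nu]_x f x = \int[mu]_x (f x * (g x)%:E).
Proof. by exists nu; exact: integral_nu. Qed.

End density.

(** * Change of scale for Lebesgue measure *)

Section lebesgue_scaling.
Local Open Scope ereal_scope.
Context (R : realType).
Notation mu := (@lebesgue_measure R).
Notation mR := (measurableTypeR R).
Variables (a : R) (a0 : (0 < a)%R).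

Let scale (x : mR) : mR := (a * x)%R.

Let mscal : measurable_fun setT scale.
Proof. exact: mulrl_measurable. Qed.

Let pf : {measure set mR -> \bar R}.
Proof. by refine (pushforward mu scale); exact: mscal. Defined.

Let nu : {measure set mR -> \bar R} := mscale (NngNum (ltW a0)) pf.

(** Lebesgue measure is determined by its values on half-open intervals; the image under
    multiplication by [a] divides their lengths by [a], and the factor [a] in [nu] restores them. *)
Let nuE A : measurable A -> mu A = nu A.
Proof.
apply: lebesgue_measure_unique => X [[b c] _ <-].
rewrite /nu /= /mscale /= /pushforward.
rewrite [X in _ = _ * mu X](_ : _ = `](b / a)%R, (c / a)%R]%classic); last first.
  apply/seteqP; split => x /=; rewrite !in_itv/= /scale.
    by rewrite ltr_pdivrMr// ler_pdivlMr// [(x * a)%R]mulrC.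
  by rewrite ltr_pdivrMr// ler_pdivlMr// [(x * a)%R]mulrC.
rewrite !lebesgue_measure_itv/= !lte_fin ltr_pM2r ?invr_gt0//.
case: ifPn => _; last by rewrite mule0.
by rewrite -!EFinB -EFinM; congr (_%:E); field; rewrite gt_eqF.
Qed.

Lemma ge0_integral_lebesgue_scale (f : R -> \bar R) :
  (forall x, 0 <= f x) -> measurable_fun setT f ->
  \int[mu]_x f x = a%:E * \int[mu]_x f (a * x)%R.
Proof.
move=> f0 mf.
rewrite (eq_measure_integral nu)//; last by move=> A mA _; exact: nuE.
by rewrite ge0_integral_mscale//= /pf ge0_integral_pushforward.
Qed.

End lebesgue_scaling.

(** * The coordinates x and w = y / x *)

Section ratio_substitution.
Local Open Scope ereal_scope.
Context (R : realType).
Notation mu := (@lebesgue_measure R).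
Notation mR := (measurableTypeR R).

(** For each fixed x > 0 this is the scaling y = x w, with Jacobian x; Tonelli then exchanges the
    order. Vanishing of [F] for x <= 0 keeps the right-hand integrand nonnegative there. *)
Lemma ge0_integral_ratio (F : mR * mR -> \bar R) :
  (forall z, 0 <= F z) -> measurable_fun setT F ->
  (forall x y : R, (x <= 0)%R -> F (x, y) = 0) ->
  \int[mu]_x \int[mu]_y F (x, y) =
  \int[mu]_w \int[mu]_x (x%:E * F (x, x * w)%R).
Proof.
move=> F0 mF Fx.
have mG : measurable_fun [set: mR * mR]
    (fun z => z.1%:E * F (z.1, z.1 * z.2)%R).
  apply: emeasurable_funM; first by apply/measurable_EFinP; exact: (@measurable_fst _ _ mR mR).
  apply: measurableT_comp => //; apply: measurable_fun_pair => /=.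
    exact: measurable_fst.
  by apply: measurable_funM;
    [exact: (@measurable_fst _ _ mR mR)|exact: (@measurable_snd _ _ mR mR)].
rewrite -(fubini_tonelli (fun z : mR * mR => z.1%:E * F (z.1, z.1 * z.2)%R))//=.
- apply: eq_integral => x _.
  have [x0|x0] := leP x 0%R.
    under eq_integral do rewrite Fx//.
    by under [RHS]eq_integral do rewrite Fx// mule0.
  rewrite (ge0_integral_lebesgue_scale x0)//; last first.
    by apply: (measurableT_comp mF); exact: measurable_fun_pair.
  rewrite ge0_integralZl ?lee_fin ?ltW//.
  by apply: (measurableT_comp mF); exact: measurable_fun_pair.
- move=> [x y] /=; have [x0|x0] := leP x 0%R; first by rewrite Fx// mule0.
  by rewrite mule_ge0// lee_fin ltW.
Qed.

End ratio_substitution.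

(** * The Gamma recurrence with a rate parameter *)

Section gamma_recurrence.
Local Open Scope ereal_scope.
Context (R : realType).
Notation mu := (@lebesgue_measure R).
Notation mR := (measurableTypeR R).

Lemma integral_expR_tail (l u : R) : (0 < l)%R ->
  \int[mu]_(x in `]u, +oo[) (l * expR (- (l * x)))%:E = (expR (- (l * u)))%:E.
Proof.
move=> l0.
have cE : continuous (fun x : R => expR (- (l * x)))%R.
  move=> z; apply: continuous_comp; last exact: continuous_expR.
  by apply: continuousN; exact: mulrl_continuous.
have clE : continuous (fun x : R => l * expR (- (l * x)))%R.
  by move=> z; apply: cvgMl_tmp; exact: cE.
rewrite integral_itv_obnd_cbnd; last first.
  apply/measurable_funTS/measurable_EFinP.
  exact: continuous_measurable_fun clE.
rewrite (@ge0_continuous_FTC2y _ _ (fun x => - expR (- (l * x)))%R _ 0%R)//.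
- by rewrite EFinN oppeK add0e.
- by move=> x _; rewrite mulr_ge0 ?ltW ?expR_gt0.
- exact/continuous_subspaceT.
- rewrite -oppr0; apply: cvgN.
  apply: (@cvg_comp _ _ _ (fun x => l * x)%R (fun z => expR (- z))%R _ (pinfty_nbhs R)).
    exact: gt0_cvgMry.
  exact: cvgr_expR.
- by apply: cvgN; apply/cvg_at_right_filter; exact: cE.
- move=> x _; rewrite derive1E derive_val /GRing.scale/=; ring.
Qed.

(** With s > 0 the integrand is continuous up to the endpoint 0, where [powR] takes the value 0, so
    the fundamental theorem of calculus applies on the closed interval. *)
Lemma integral_powR (s x : R) : (0 < s)%R -> (0 < x)%R ->
  \int[mu]_(u in `]0%R, x[) ((s + 1) * u `^ s)%:E = (x `^ (s + 1))%:E.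
Proof.
move=> s0 x0.
have s1 : (0 < s + 1)%R by rewrite addr_gt0.
have pow_cvg (r y : R) : (0 < y)%R -> (z `^ r)%R @[z --> y] --> (y `^ r)%R.
  move=> y0; suff : {for y, continuous (fun z : R => z `^ r)%R} by [].
  apply/differentiable_continuous/derivable1_diffP.
  by apply: derivable_powR; rewrite in_itv/= y0.
have pow_cvg0 (r : R) : (0 < r)%R -> (z `^ r)%R @[z --> 0%R^'+] --> (0 `^ r)%R.
  by move=> r0; rewrite powR0 ?gt_eqF//; exact: powR_cvg0.
have mp : measurable_fun setT (fun u : R => (s + 1) * u `^ s)%R.
  by apply: measurable_funM => //; exact: measurable_powR.
rewrite integral_itv_bndo_bndc; last exact/measurable_funTS/measurable_EFinP.
rewrite integral_itv_obnd_cbnd; last exact/measurable_funTS/measurable_EFinP.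
rewrite (@continuous_FTC2 _ _ (fun z : R => z `^ (s + 1))%R)//.
- by rewrite powR0 ?gt_eqF// sube0.
- apply/continuous_within_itvP => //; split.
  + move=> y; rewrite in_itv/= => /andP[y0 _].
    by apply: cvgMl_tmp; exact: pow_cvg.
  + by apply: cvgMl_tmp; exact: pow_cvg0.
  + by apply: cvgMl_tmp; apply: cvg_at_left_filter; exact: pow_cvg.
- split.
  + move=> y; rewrite in_itv/= => /andP[y0 _].
    by apply: derivable_powR; rewrite in_itv/= y0.
  + exact: pow_cvg0.
  + by apply: cvg_at_left_filter; exact: pow_cvg.
- move=> y; rewrite in_itv/= => /andP[y0 _].
  by rewrite powR_derive1 ?in_itv/= ?y0// addrK.
Qed.

(** Both sides are the double integral of the kernel [K], supported on 0 < u < x: integrating x out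
    first gives the left side, u first the right side. This is integration by parts in Tonelli form,
    hence free of boundary terms and finiteness conditions. *)
Lemma integral_powR_expR_recurrence (s l : R) : (0 < s)%R -> (0 < l)%R ->
  \int[mu]_(x in `]0%R, +oo[) ((s + 1) * x `^ s * expR (- (l * x)))%:E =
  \int[mu]_(x in `]0%R, +oo[) (l * x `^ (s + 1) * expR (- (l * x)))%:E.
Proof.
move=> s0 l0.
pose K (z : mR * mR) : R := (if (0 < z.1) && (z.1 < z.2) then
  (s + 1) * z.1 `^ s * (l * expR (- (l * z.2))) else 0)%R.
have K0 z : 0 <= (K z)%:E.
  rewrite lee_fin /K; case: ifP => // _.
  by rewrite !mulr_ge0 ?powR_ge0 ?expR_ge0 ?addr_ge0 ?(ltW l0) ?(ltW s0).
have m1 : measurable_fun [set: mR * mR] fst := @measurable_fst _ _ mR mR.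
have m2 : measurable_fun [set: mR * mR] snd := @measurable_snd _ _ mR mR.
have mK : measurable_fun setT (EFin \o K).
  apply/measurable_EFinP; apply: measurable_fun_ifT => //.
    by apply: measurable_and; apply: measurable_fun_ltr.
  apply: measurable_funM; apply: measurable_funM => //.
    exact: (measurableT_comp (measurable_powR _) m1).
  apply: (measurableT_comp (@measurable_expR R)).
  by apply: measurable_funN; exact: measurable_funM.
rewrite integral_mkcond [RHS]integral_mkcond.
transitivity (\int[mu]_u \int[mu]_x (K (u, x))%:E); last first.
  rewrite (fubini_tonelli (EFin \o K))//; apply: eq_integral => x _.
  rewrite patchE; case: ifPn => [|x0]; last first.
    apply: integral0_eq => u _ /=; rewrite /K /=; case: ifP => // /andP[u0 ux].
    by move: x0; rewrite notin_setE /= in_itv/= andbT => /negP; rewrite (lt_trans u0).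
  rewrite inE/= in_itv/= andbT => x0.
  transitivity (\int[mu]_(u in `]0%R, x[) ((l * expR (- (l * x)))%:E * ((s + 1) * u `^ s)%:E)).
    rewrite [RHS]integral_mkcond; apply: eq_integral => u _ /=; rewrite patchE.
    rewrite mem_setE in_itv/= /K/=; case: ifP => // _.
    by rewrite -EFinM mulrC.
  rewrite ge0_integralZl//.
  + by rewrite integral_powR// -EFinM; congr (_%:E); ring.
  + apply/measurable_funTS/measurable_EFinP.
    by apply: measurable_funM => //; exact: measurable_powR.
  + by move=> u _; rewrite lee_fin mulr_ge0 ?powR_ge0 ?addr_ge0 ?(ltW s0).
  + by rewrite lee_fin mulr_ge0 ?expR_ge0 ?(ltW l0).
apply: eq_integral => u _.
rewrite patchE; case: ifPn => [|u0]; last first.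
  apply/esym/integral0_eq => x _ /=; rewrite /K /=; case: ifP => // /andP[u0' ux].
  by move: u0; rewrite notin_setE /= in_itv/= andbT u0'.
rewrite inE/= in_itv/= andbT => u0.
transitivity (\int[mu]_(x in `]u, +oo[) (((s + 1) * u `^ s)%:E * (l * expR (- (l * x)))%:E)).
  rewrite ge0_integralZl//.
  + by rewrite integral_expR_tail// -EFinM.
  + apply/measurable_funTS/measurable_EFinP.
    apply: measurable_funM => //.
    apply: (measurableT_comp (@measurable_expR R)).
    by apply: measurable_funN; exact: measurable_funM.
  + by move=> x _; rewrite lee_fin mulr_ge0 ?expR_ge0 ?(ltW l0).
  + by rewrite lee_fin mulr_ge0 ?powR_ge0 ?addr_ge0 ?(ltW s0).
rewrite integral_mkcond; apply: eq_integral => x _ /=; rewrite patchE.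
by rewrite mem_setE in_itv/= andbT /K/= u0/=; case: ifP.
Qed.

End gamma_recurrence.

(** * Lebesgue measure on the plane *)

Section lebesgue_plane.
Local Open Scope ereal_scope.
Context (R : realType).
Notation mu := (@lebesgue_measure R).
Notation mR := (measurableTypeR R).

(* The canonical sigma-finite structure of a product [m1 \x m2] in the library
   is the one for subprobabilities, hence this copy. *)
Definition lebesgue_plane : set (mR * mR) -> \bar R := mu \x mu.

HB.instance Definition _ := Measure.on lebesgue_plane.

Let lebesgue_plane_sigma_finite : sigma_finite setT lebesgue_plane.
Proof.
pose I n : set mR := `[(- n%:R)%R, n%:R%R]%classic.
exists (fun n => I n `*` I n).
  apply/seteqP; split => // -[x y] _ /=.
  pose n := Num.truncn (Num.max `|x : R| `|y : R|)%R.
  have : (Num.max `|x : R| `|y : R| < n.+1%:R)%R by exact: truncnS_gt.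
  rewrite gt_max => /andP[xn yn]; exists n.+1 => //.
  by split; rewrite /I /= in_itv/= -ler_norml ltW.
have mI n : measurable (I n) by exact: measurable_itv.
have muI n : mu (I n) < +oo.
  by rewrite lebesgue_measure_itv/=; case: ifP => // _; rewrite -EFinB ltry.
move=> n; split; first exact: measurableX.
rewrite /lebesgue_plane product_measure1E// lte_mul_pinfty//; last exact: muI.
by rewrite ge0_fin_numE//; exact: muI.
Qed.

HB.instance Definition _ := Measure_isSigmaFinite.Build _ _ _ lebesgue_plane
  lebesgue_plane_sigma_finite.

Lemma ge0_integral_lebesgue_plane (f : mR * mR -> \bar R) :
  (forall z, 0 <= f z) -> measurable_fun setT f ->
  \int[lebesgue_plane]_z f z = \int[mu]_x \int[mu]_y f (x, y).
Proof.
by move=> f0 mf; exact: (@fubini_tonelli1 _ _ mR mR R mu mu f mf f0).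
Qed.

Lemma ge0_iterated_integralZl (k : R) (f : mR * mR -> \bar R) :
  (0 <= k)%R -> (forall z, 0 <= f z) -> measurable_fun setT f ->
  \int[mu]_x \int[mu]_y (k%:E * f (x, y)) =
  k%:E * \int[mu]_x \int[mu]_y f (x, y).
Proof.
move=> k0 f0 mf.
rewrite -(ge0_integral_lebesgue_plane f0 mf).
have mkf : measurable_fun setT (fun z => k%:E * f z).
  by apply: emeasurable_funM => //; exact: measurable_cst.
have kf0 z : 0 <= k%:E * f z by rewrite mule_ge0.
rewrite -(ge0_integral_lebesgue_plane kf0 mkf).
by apply: (ge0_integralZl _ _ mf).
Qed.

End lebesgue_plane.


(** * Image measures that agree on rectangles *)

Section integral_rectangles.
Local Open Scope ereal_scope.
Context d d' d1 d2 (X : measurableType d) (X' : measurableType d')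
  (Z1 : measurableType d1) (Z2 : measurableType d2) (R : realType).
Variables (m : {measure set X -> \bar R}) (m' : {measure set X' -> \bar R}).
Variables (phi : X -> Z1 * Z2) (phi' : X' -> Z1 * Z2).
Hypotheses (mphi : measurable_fun setT phi) (mphi' : measurable_fun setT phi').
Hypothesis mfin : m setT < +oo.
Hypothesis mE : forall A B, measurable A -> measurable B ->
  m (phi @^-1` (A `*` B)) = m' (phi' @^-1` (A `*` B)).

Let pf : {measure set (Z1 * Z2) -> \bar R}.
Proof. by refine (pushforward m phi); exact: mphi. Defined.

Let pf' : {measure set (Z1 * Z2) -> \bar R}.
Proof. by refine (pushforward m' phi'); exact: mphi'. Defined.

(** Measurable rectangles are stable under intersection and generate the product sigma-algebra, so
    agreement on them extends to all measurable sets once the total mass is finite. *)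
Let pfE C : measurable C -> pf C = pf' C.
Proof.
apply: (@measure_unique _ _ _
  [set A `*` B | A in measurable & B in measurable] (fun=> setT)).
- by rewrite measurable_prod_measurableType.
- move=> _ _ [A mA [B mB <-]] [A' mA' [B' mB' <-]].
  exists (A `&` A'); first exact: measurableI.
  by exists (B `&` B'); [exact: measurableI|rewrite setXI].
- by move=> _; exists setT => //; exists setT => //; rewrite setXTT.
- by rewrite bigcup_const//; exists 0%N.
- by move=> _ [A mA [B mB <-]]; exact: mE.
- by move=> _; rewrite /pf /= /pushforward preimage_setT.
Qed.

(** Passes from rectangle events, which are all that the model prescribes, to expectations of
    nonnegative functions of the pair. *)
Lemma ge0_eq_integral_rectangles (h : Z1 * Z2 -> \bar R) :
  (forall z, 0 <= h z) -> measurable_fun setT h ->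
  \int[m]_x h (phi x) = \int[m']_x h (phi' x).
Proof.
move=> h0 mh.
have := @ge0_integral_pushforward _ _ _ _ _ _ mphi m setT h measurableT mh (fun x _ => h0 x).
rewrite preimage_setT /= => <-.
have := @ge0_integral_pushforward _ _ _ _ _ _ mphi' m' setT h measurableT mh (fun x _ => h0 x).
rewrite preimage_setT /= => <-.
rewrite -/(\int[pf]_z h z) -/(\int[pf']_z h z).
by apply: eq_measure_integral => A mA _; exact: pfE.
Qed.

End integral_rectangles.

(** * Expectations under the scale mixture *)

Section scale_mixture.
Local Open Scope ereal_scope.
Context d (T : measurableType d) (R : realType).
Notation mu := (@lebesgue_measure R).
Notation mR := (measurableTypeR R).
Variables (P : probability T R) (Pi : probability mR R).
Variables (S1 S2 : T -> R) (f1 f2 : R -> R) (a1 a2 : R).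
Hypotheses (mS1 : measurable_fun setT S1) (mS2 : measurable_fun setT S2).
Hypotheses (f1_ge0 : forall x, (0 <= f1 x)%R) (f2_ge0 : forall x, (0 <= f2 x)%R).
Hypotheses (mf1 : measurable_fun setT f1) (mf2 : measurable_fun setT f2).
Hypothesis lawE : forall C1 C2 : set R, measurable C1 -> measurable C2 ->
  P [set w | C1 (S1 w) /\ C2 (S2 w)] = \int[Pi]_(t in `]0%R, +oo[)
   ((\int[mu]_(x in (fun x => a1 / t * x)%R @^-1` C1) (f1 x)%:E) *
    (\int[mu]_(y in (fun y => a2 / t * y)%R @^-1` C2) (f2 y)%:E)).

Let Q : {measure set (mR * (mR * mR)) -> \bar R} := Pi \x @lebesgue_plane R.

Let m1 : measurable_fun [set: mR * (mR * mR)] (fun z => z.1 : R).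
Proof. exact: (@measurable_fst _ _ mR (mR * mR)%type). Qed.

Let m2 : measurable_fun [set: mR * (mR * mR)] (fun z => z.2.1 : R).
Proof.
apply: (measurableT_comp (@measurable_fst _ _ mR mR)).
exact: (@measurable_snd _ _ mR (mR * mR)%type).
Qed.

Let m3 : measurable_fun [set: mR * (mR * mR)] (fun z => z.2.2 : R).
Proof.
apply: (measurableT_comp (@measurable_snd _ _ mR mR)).
exact: (@measurable_snd _ _ mR (mR * mR)%type).
Qed.

(** Joint density of the mixing variable and the two unscaled variables relative to [Q]; the cutoff
    at t > 0 mirrors the domain of integration in [lawE]. *)
Let D (z : mR * (mR * mR)) : R :=
  (if 0 < z.1 then f1 z.2.1 * f2 z.2.2 else 0)%R.

Let D_ge0 z : (0 <= D z)%R.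
Proof. by rewrite /D; case: ifP => // _; rewrite mulr_ge0. Qed.

Let mD : measurable_fun setT D.
Proof.
apply: measurable_fun_ifT => //; first exact: measurable_fun_ltr.
by apply: measurable_funM; exact: measurableT_comp.
Qed.

(** The scale is carried by this map and not by the density, so [f1] and [f2] are never rescaled. *)
Let G (z : mR * (mR * mR)) : mR * mR :=
  (a1 / z.1 * z.2.1, a2 / z.1 * z.2.2)%R.

Let mG : measurable_fun setT G.
Proof.
by apply: measurable_fun_pair => /=; apply: measurable_funM => //;
  exact: measurable_fun_div.
Qed.

Let integral_Q (h : mR * mR -> \bar R) :
  (forall z, 0 <= h z) -> measurable_fun setT h ->
  \int[Q]_z (h (G z) * (D z)%:E) = \int[Pi]_(t in `]0%R, +oo[)
    \int[mu]_x \int[mu]_y (h (a1 / t * x, a2 / t * y)%R * (f1 x * f2 y)%:E).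
Proof.
move=> h0 mh.
have mhD : measurable_fun setT (fun z => h (G z) * (D z)%:E).
  apply: emeasurable_funM; first exact: (measurableT_comp mh).
  exact/measurable_EFinP.
have hD0 z : 0 <= h (G z) * (D z)%:E by rewrite mule_ge0// lee_fin.
rewrite /Q (fubini_tonelli1 (fun z => h (G z) * (D z)%:E))//.
rewrite [RHS]integral_mkcond; apply: eq_integral => t _.
rewrite patchE mem_setE in_itv/= andbT /fubini_F/=.
case: ifPn => t0; last first.
  by apply: integral0_eq => z _; rewrite /D/= (negbTE t0) mule0.
have mt : measurable_fun setT (fun z => h (G (t, z)) * (D (t, z))%:E).
  exact: (measurableT_comp mhD).
rewrite (ge0_integral_lebesgue_plane (fun z => hD0 (t, z)) mt).
apply: eq_integral => x _; apply: eq_integral => y _.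
by rewrite /D/= t0.
Qed.

(** The law of ([S1], [S2]) is the image under [G] of the measure with density [D] over [Q]: for the
    indicator of a rectangle the inner double integral factors into the product that [lawE]
    prescribes. *)
Lemma integral_scale_mixture (h : mR * mR -> \bar R) :
  (forall z, 0 <= h z) -> measurable_fun setT h ->
  \int[P]_w h (S1 w, S2 w) = \int[Pi]_(t in `]0%R, +oo[)
    \int[mu]_x \int[mu]_y (h (a1 / t * x, a2 / t * y)%R * (f1 x * f2 y)%:E).
Proof.
move=> h0 mh.
have [nu nuI] := measure_of_density Q D_ge0 mD.
rewrite -integral_Q// -(nuI (fun z => h (G z)))//; last first.
  exact: (measurableT_comp mh).
apply: (@ge0_eq_integral_rectangles _ _ _ _ _ _ _ _ _ _ _
  (fun w => (S1 w, S2 w) : mR * mR) G) => //.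
- exact: measurable_fun_pair.
- by rewrite -ge0_fin_numE// fin_num_measure.
move=> A B mA mB.
have mAB : measurable (A `*` B) by exact: measurableX.
have mGAB : measurable (G @^-1` (A `*` B)).
  by rewrite -[X in measurable X]setTI; exact: mG.
have -> : nu (G @^-1` (A `*` B)) = \int[nu]_z (\1_(A `*` B) (G z))%:E.
  by rewrite -[RHS]/(\int[nu]_z (\1_(G @^-1` (A `*` B)) z)%:E) integral_indic// setIT.
have i0 z : 0 <= (\1_(A `*` B) z : R)%:E by rewrite lee_fin.
have mi : measurable_fun setT (fun z => (\1_(A `*` B) z : R)%:E).
  exact/measurable_EFinP.
rewrite (nuI _ (fun z => i0 (G z)) (measurableT_comp mi mG)).
rewrite (integral_Q i0 mi).
rewrite [LHS](lawE mA mB); apply: eq_integral => t _.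
have indE (f : R -> R) C a x : (EFin \o f) \_ ((fun x => a / t * x)%R @^-1` C) x =
    (\1_C (a / t * x)%R * f x)%:E.
  rewrite patchE.
  have -> : (x \in (fun x => a / t * x)%R @^-1` C) = ((a / t * x)%R \in C).
    by apply/idP/idP; rewrite !inE.
  by rewrite indicE; case: (_ \in C); rewrite ?mul1r ?mul0r.
rewrite integral_mkcond [X in _ * X]integral_mkcond.
under eq_integral do rewrite indE.
under [X in _ * X]eq_integral do rewrite indE.
have mif (f : R -> R) C a : measurable_fun setT f -> measurable C ->
    measurable_fun setT (fun x : mR => (\1_C (a / t * x)%R * f x)%:E).
  move=> mf mC; apply/measurable_EFinP; apply: measurable_funM => //.
  have mIC : measurable_fun setT (\1_C : mR -> R) by exact: measurable_indic.
  exact: (measurableT_comp mIC (@mulrl_measurable R setT (a / t)%R)).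
have if0 (f : R -> R) C a x : (forall x, 0 <= f x)%R ->
    0 <= (\1_C (a / t * x)%R * f x)%:E.
  by move=> f0; rewrite lee_fin mulr_ge0.
rewrite -ge0_integralZr//; last 3 first.
- exact: mif.
- by move=> x _; exact: if0.
- by apply: integral_ge0 => x _; exact: if0.
apply: eq_integral => x _; rewrite -ge0_integralZl//; last 3 first.
- exact: mif.
- by move=> y _; exact: if0.
- exact: if0.
apply: eq_integral => y _ /=; rewrite -!EFinM; congr (_%:E).
rewrite !indicE in_setX /=.
by case: (_ \in A); case: (_ \in B); rewrite /= ?mul1r ?mul0r ?mulr0.
Qed.

(** Meant for a function of the ratio y / x times a k-th power of |x|: the common factor 1 / t
    cancels in the ratio, so only t^-k comes out of the inner integral. *)
Lemma integral_scale_mixture_homogeneous (k : nat) (h H : mR * mR -> R) :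
  (forall z, 0 <= h z)%R -> measurable_fun setT h ->
  (forall z, 0 <= H z)%R -> measurable_fun setT H ->
  (forall t x y : R, 0 < t -> h (a1 / t * x, a2 / t * y) = t ^- k * H (x, y))%R ->
  \int[P]_w (h (S1 w, S2 w))%:E =
  (\int[Pi]_(t in `]0%R, +oo[) (t ^- k)%:E) *
  \int[mu]_x \int[mu]_y (H (x, y) * (f1 x * f2 y))%:E.
Proof.
move=> h0 mh H0 mH hH.
rewrite (@integral_scale_mixture (EFin \o h))//; last exact/measurable_EFinP.
pose F (z : mR * mR) : \bar R := (H z * (f1 z.1 * f2 z.2))%:E.
have F0 z : 0 <= F z by rewrite lee_fin mulr_ge0// mulr_ge0.
have mF : measurable_fun setT F.
  apply/measurable_EFinP; apply: measurable_funM => //; apply: measurable_funM.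
    exact: (measurableT_comp mf1 (@measurable_fst _ _ mR mR)).
  exact: (measurableT_comp mf2 (@measurable_snd _ _ mR mR)).
rewrite -ge0_integralZr; first last.
- by apply: integral_ge0 => x _; apply: integral_ge0 => y _; exact: (F0 (x, y)).
- by move=> t; rewrite /= in_itv/= andbT => t0; rewrite lee_fin invr_ge0 exprn_ge0 ?ltW.
- apply/measurable_funTS/measurable_EFinP.
  exact: (measurableT_comp (@measurable_inv R) (@exprn_measurable R setT k)).
- exact: measurable_itv.
apply: eq_integral => t; rewrite inE/= in_itv/= andbT => t0.
have tk0 : (0 <= t ^- k)%R by rewrite invr_ge0 exprn_ge0 ?ltW.
rewrite -(ge0_iterated_integralZl tk0 F0 mF).
apply: eq_integral => x _; apply: eq_integral => y _.
by rewrite /= hH// /F -EFinM -[RHS]EFinM -mulrA.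
Qed.

End scale_mixture.

(** * The chi-square inequality *)

Section chi2_moments.
Context (R : realType).
Notation mu := (@lebesgue_measure R).
Notation mR := (measurableTypeR R).

Lemma chi2_pdf_le0 (m : nat) (x : R) : x <= 0 -> chi2_pdf m x = 0.
Proof.
move=> x0; rewrite /chi2_pdf patchE ifF// mem_setE in_itv/= andbT.
by rewrite ltNge x0.
Qed.

Lemma chi2_pdf_gt0E (m : nat) (x : R) : 0 < x ->
  chi2_pdf m x = x `^ (m%:R / 2 - 1) * expR (- x / 2)
            / (2 `^ (m%:R / 2) * Gamma (m%:R / 2)).
Proof. by move=> x0; rewrite /chi2_pdf patchE ifT// mem_setE in_itv/= x0. Qed.

Lemma Gamma_ge0 (a : R) : 0 <= Gamma a.
Proof.
by apply: Rintegral_ge0 => x _; rewrite mulr_ge0 ?powR_ge0 ?expR_ge0.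
Qed.

Lemma chi2_pdf_ge0 (m : nat) (x : R) : 0 <= chi2_pdf m x.
Proof.
have [x0|x0] := leP x 0; first by rewrite chi2_pdf_le0.
rewrite chi2_pdf_gt0E//.
by rewrite mulr_ge0 ?invr_ge0 ?mulr_ge0 ?powR_ge0 ?expR_ge0 ?Gamma_ge0.
Qed.

Lemma measurable_chi2_pdf (m : nat) : measurable_fun setT (@chi2_pdf R m).
Proof.
apply/(measurable_restrictT _ _).1; first exact: measurable_itv.
apply: measurable_funTS.
apply: measurable_funM => //; apply: measurable_funM.
  exact: measurable_powR.
apply: (measurableT_comp (@measurable_expR R)).
by apply: measurable_funM => //; exact: oppr_measurable.
Qed.

(* With s = (m1 + m2) / 2 and l = (1 + w) / 2, the substitution y = x w turns the
   chi-square densities into [x `^ s * expR (- (l * x))] up to a factor free of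
   x; there the factor 2 (s + 1) = m1 + m2 + 2 is worth 2 l x = (1 + w) x by
   the recurrence, and w <= rho * w. *)
Lemma chi2_ratio_moment (m1 m2 : nat) (rho : R) (g : R -> R) :
  (0 < m1)%N -> (0 < m2)%N -> 1 <= rho ->
  measurable_fun setT g -> (forall z, 0 <= g z) ->
  (forall z, z <= 0 -> g z = 0) ->
  (\int[mu]_x \int[mu]_y ((m1 + m2 + 2)%:R * (g (rho * (y / x)) * `|x|)
      * (chi2_pdf m1 x * chi2_pdf m2 y))%:E
   <= \int[mu]_x \int[mu]_y (g (rho * (y / x)) * (1 + rho * (y / x)) * x ^+ 2
      * (chi2_pdf m1 x * chi2_pdf m2 y))%:E)%E.
Proof.
move=> m1_gt0 m2_gt0 rho1 mg g0 gle0.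
have rho0 : 0 < rho by exact: lt_le_trans rho1.
pose f1 := @chi2_pdf R m1; pose f2 := @chi2_pdf R m2.
pose F1 (z : mR * mR) : R :=
  (m1 + m2 + 2)%:R * (g (rho * (z.2 / z.1)) * `|z.1|) * (f1 z.1 * f2 z.2).
pose F2 (z : mR * mR) : R :=
  g (rho * (z.2 / z.1)) * (1 + rho * (z.2 / z.1)) * z.1 ^+ 2
    * (f1 z.1 * f2 z.2).
have p1 : measurable_fun [set: mR * mR] fst := @measurable_fst _ _ mR mR.
have p2 : measurable_fun [set: mR * mR] snd := @measurable_snd _ _ mR mR.
have mr : measurable_fun [set: mR * mR] (fun z => rho * (z.2 / z.1) : R).
  by apply: measurable_funM => //; exact: measurable_fun_div.
have mf12 : measurable_fun [set: mR * mR] (fun z => f1 z.1 * f2 z.2).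
  apply: measurable_funM.
    exact: (measurableT_comp (measurable_chi2_pdf m1) p1).
  exact: (measurableT_comp (measurable_chi2_pdf m2) p2).
have mgr := measurableT_comp mg mr.
have mF1 : measurable_fun setT (EFin \o F1).
  apply/measurable_EFinP; apply: measurable_funM => //.
  apply: measurable_funM => //; apply: measurable_funM => //.
  by apply: (measurableT_comp (@normr_measurable R setT) p1).
have mF2 : measurable_fun setT (EFin \o F2).
  apply/measurable_EFinP; apply: measurable_funM => //.
  apply: measurable_funM.
    by apply: measurable_funM => //; exact: measurable_funD.
  exact: measurable_funX.
have f120 x y : 0 <= f1 x * f2 y by rewrite mulr_ge0 ?chi2_pdf_ge0.
have F10 z : (0 <= (F1 z)%:E)%E by rewrite lee_fin !mulr_ge0 ?chi2_pdf_ge0.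
(* Wherever 1 + z could be negative, [g] vanishes. *)
have gz0 z : 0 <= g z * (1 + z).
  have [z0|z0] := leP z 0; first by rewrite gle0// mul0r.
  by rewrite mulr_ge0// addr_ge0// ltW.
have F20 z : (0 <= (F2 z)%:E)%E.
  by rewrite lee_fin mulr_ge0// mulr_ge0 ?sqr_ge0.
have f12x x y : x <= 0 -> f1 x * f2 y = 0.
  by move=> x0; rewrite /f1 chi2_pdf_le0// mul0r.
have F1x (x y : R) : x <= 0 -> (F1 (x, y))%:E = 0%E.
  by move=> x0; rewrite /F1 /= f12x// mulr0.
have F2x (x y : R) : x <= 0 -> (F2 (x, y))%:E = 0%E.
  by move=> x0; rewrite /F2 /= f12x// mulr0.
rewrite (ge0_integral_ratio F10 mF1 F1x) (ge0_integral_ratio F20 mF2 F2x).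
have xF0 (F : mR * mR -> R) : (forall z, 0 <= (F z)%:E)%E ->
    (forall x y : R, x <= 0 -> (F (x, y))%:E = 0%E) ->
    forall x w : R, (0 <= x%:E * (F (x, x * w))%:E)%E.
  move=> F0 Fx x w; have [x0|x0] := leP x 0; first by rewrite Fx// mule0.
  by rewrite mule_ge0// lee_fin ltW.
(* The coordinates are swapped to (w, x) because Tonelli's measurability statement integrates out
   the second one. *)
have mxF (F : mR * mR -> R) : measurable_fun setT (EFin \o F) ->
    measurable_fun [set: mR * mR] (fun z => z.2%:E * (F (z.2, z.2 * z.1))%:E)%E.
  move=> mF; apply: emeasurable_funM; first exact/measurable_EFinP.
  apply: (measurableT_comp mF); apply: measurable_fun_pair => //=.
  exact: measurable_funM.
have mxFw (F : mR * mR -> R) (w : R) : measurable_fun setT (EFin \o F) ->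
    measurable_fun [set: mR] (fun x => x%:E * (F (x, x * w))%:E)%E.
  move=> mF; have mw : measurable_fun [set: mR] (fun x : mR => (w, x) : mR * mR).
    exact: measurable_fun_pair.
  exact: (measurableT_comp (mxF F mF) mw).
have mIF (F : mR * mR -> R) : (forall z, 0 <= (F z)%:E)%E ->
    (forall x y : R, x <= 0 -> (F (x, y))%:E = 0%E) ->
    measurable_fun setT (EFin \o F) ->
    measurable_fun [set: mR] (fun w => \int[mu]_x (x%:E * (F (x, x * w))%:E))%E.
  move=> F0 Fx mF.
  exact: (measurable_fun_fubini_tonelli_F _ (mxF F mF) (fun z => xF0 F F0 Fx z.2 z.1)).
apply: ge0_le_integral.
- exact: measurableT.
- by move=> w _; apply: integral_ge0 => x _; exact: (xF0 F1).
- exact: (mIF F1).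
- exact: (mIF F2).
move=> w _ /=.
(* For w <= 0 and x > 0 the point y = x w lies outside the support of [f2], so the left integral
   vanishes. *)
have [w0|w0] := leP w 0.
  rewrite integral0_eq; first by apply: integral_ge0 => x _; exact: (xF0 F2).
  move=> x _ /=; have [x0|x0] := leP x 0; first by rewrite F1x// mule0.
  rewrite /F1 /= /f2 [chi2_pdf m2 _]chi2_pdf_le0; last by rewrite pmulr_rle0.
  by rewrite !mulr0 mule0.
pose s : R := (m1 + m2)%:R / 2; pose l : R := (1 + w) / 2.
have s0 : 0 < s by rewrite divr_gt0// ltr0n addn_gt0 m1_gt0.
have l0 : 0 < l by rewrite divr_gt0// addr_gt0.
pose k1 : R := (2 `^ (m1%:R / 2) * Gamma (m1%:R / 2))^-1.
pose k2 : R := (2 `^ (m2%:R / 2) * Gamma (m2%:R / 2))^-1.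
have k10 : 0 <= k1 by rewrite invr_ge0 mulr_ge0 ?powR_ge0 ?Gamma_ge0.
have k20 : 0 <= k2 by rewrite invr_ge0 mulr_ge0 ?powR_ge0 ?Gamma_ge0.
pose K : R := g (rho * w) * k1 * k2 * w `^ (m2%:R / 2 - 1).
have K0 : 0 <= K.
  by rewrite mulr_ge0 ?powR_ge0// mulr_ge0// mulr_ge0.
(* The two factors x bring the sum of the exponents m1 / 2 - 1 and m2 / 2 - 1 up to [s]. In [F1]
   they come from the Jacobian and from |x|; [F2] supplies one more, hence the exponent [s + 1]
   there. *)
have f12E (x : R) : 0 < x -> x ^+ 2 * (f1 x * f2 (x * w)) =
    k1 * k2 * w `^ (m2%:R / 2 - 1) * (x `^ s * expR (- (l * x))).
  move=> x0; rewrite /f1 /f2 !chi2_pdf_gt0E ?mulr_gt0// -/k1 -/k2.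
  have -> : expR (- (l * x)) = expR (- x / 2) * expR (- (x * w) / 2).
    by rewrite -expRD; congr expR; rewrite /l; field.
  have -> : x `^ s = (x * x `^ (m1%:R / 2 - 1)) * (x * x `^ (m2%:R / 2 - 1)).
    rewrite !mulr_powRB1 ?(ltW x0) ?divr_gt0 ?ltr0n// -powRD; last first.
      by rewrite (gt_eqF x0) implybT.
    by congr powR; rewrite /s natrD mulrDl.
  by rewrite powRM ?ltW// expr2; ring.
have divE (x : R) : 0 < x -> x * w / x = w.
  by move=> x0; rewrite mulrAC divff ?mul1r// gt_eqF.
have xF1E (x : R) : 0 < x -> x * F1 (x, x * w) =
    2 * K * ((s + 1) * x `^ s * expR (- (l * x))).
  move=> x0; rewrite /F1 /= divE// gtr0_norm//.
  transitivity ((m1 + m2 + 2)%:R * g (rho * w) * (x ^+ 2 * (f1 x * f2 (x * w)))).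
    by ring.
  by rewrite f12E// /K /s natrD; field.
have xF2E (x : R) : 0 < x -> x * F2 (x, x * w) =
    (1 + rho * w) * K * (x `^ (s + 1) * expR (- (l * x))).
  move=> x0; rewrite /F2 /= divE//.
  transitivity (g (rho * w) * (1 + rho * w) * x * (x ^+ 2 * (f1 x * f2 (x * w)))).
    by ring.
  rewrite f12E// powRD; last by rewrite (gt_eqF x0) implybT.
  by rewrite powRr1 ?ltW// /K; ring.
have mJ (r : R) : measurable_fun [set: R] (fun x => x `^ r * expR (- (l * x))).
  apply: measurable_funM; first exact: measurable_powR.
  apply: (measurableT_comp (@measurable_expR R)).
  by apply: measurable_funN; exact: measurable_funM.
have mcJ (c r : R) :
    measurable_fun [set: R] (fun x => c * x `^ r * expR (- (l * x))).
  rewrite (_ : (fun _ => _) = (fun x => c * (x `^ r * expR (- (l * x))))).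
    exact: measurable_funM.
  by apply/funext => x; rewrite mulrA.
have J0 (r x : R) : 0 <= x `^ r * expR (- (l * x)).
  by rewrite mulr_ge0 ?powR_ge0 ?expR_ge0.
rewrite [leLHS](_ : _ = \int[mu]_(x in `]0%R, +oo[)
    ((2 * K)%:E * ((s + 1) * x `^ s * expR (- (l * x)))%:E))%E; last first.
  rewrite [RHS]integral_mkcond; apply: eq_integral => x _.
  rewrite patchE mem_setE in_itv/= andbT; case: ifPn => [x0|].
    by rewrite -!EFinM xF1E.
  by rewrite -leNgt => x0; rewrite F1x// mule0.
rewrite [leRHS](_ : _ = \int[mu]_(x in `]0%R, +oo[)
    ((1 + rho * w) * K * (x `^ (s + 1) * expR (- (l * x))))%:E)%E; last first.
  rewrite [RHS]integral_mkcond; apply: eq_integral => x _.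
  rewrite patchE mem_setE in_itv/= andbT; case: ifPn => [x0|].
    by rewrite -!EFinM xF2E.
  by rewrite -leNgt => x0; rewrite F2x// mule0.
rewrite ge0_integralZl; first last.
- by rewrite lee_fin mulr_ge0.
- by move=> x _; rewrite lee_fin -mulrA mulr_ge0// addr_ge0 ?ltW.
- apply/measurable_funTS/measurable_EFinP.
  exact: mcJ.
- exact: measurable_itv.
rewrite integral_powR_expR_recurrence// -ge0_integralZl; first last.
- by rewrite lee_fin mulr_ge0.
- by move=> x _; rewrite lee_fin -mulrA mulr_ge0// ltW.
- apply/measurable_funTS/measurable_EFinP.
  exact: mcJ.
- exact: measurable_itv.
apply: ge0_le_integral.
- exact: measurable_itv.
- move=> x _; apply: mule_ge0; rewrite lee_fin; first by rewrite mulr_ge0.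
  by rewrite -mulrA mulr_ge0// ltW.
- apply/measurable_funTS/measurable_EFinP.
  by apply: measurable_funM => //; exact: mcJ.
- apply/measurable_funTS/measurable_EFinP.
  by apply: measurable_funM => //; exact: mJ.
move=> x _; rewrite -EFinM lee_fin.
have -> : 2 * K * (l * x `^ (s + 1) * expR (- (l * x))) =
    (1 + w) * K * (x `^ (s + 1) * expR (- (l * x))) by rewrite /l; field.
rewrite ler_wpM2r// ler_wpM2r// lerD2l.
by rewrite ler_peMl// ltW.
Qed.

End chi2_moments.

(** * Inverse moments of the mixing variable *)

Section inverse_moments.
Context (R : realType) (Pi : probability (measurableTypeR R) R).
Hypothesis Pi_pos : Pi [set t : R | 0 < t] = 1%E.

Let pos_itv : [set t : R | 0 < t] = `]0, +oo[%classic.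
Proof. by apply/seteqP; split => x /=; rewrite in_itv/= andbT. Qed.

(** The complement of the half-line is a null set, and integrability makes the expectation finite,
    so that [fine] loses nothing. *)
Lemma integral_inv_moment (k : nat) :
  Pi.-integrable setT (fun t : R => (t ^- k)%:E) ->
  (\int[Pi]_(t in `]0%R, +oo[) (t ^- k)%:E)%E = (inv_moment Pi k)%:E.
Proof.
move=> ik.
have mpos : measurable (`]0%R, +oo[%classic : set (measurableTypeR R)).
  exact: measurable_itv.
have P0 : Pi (~` `]0%R, +oo[%classic) = 0%E.
  by rewrite probability_setC// -pos_itv [X in (_ - X)%E]Pi_pos subee.
rewrite /inv_moment unlock fineK; last exact: integrable_fin_num.
rewrite (negligible_integral (measurableC mpos) measurableT ik P0).
by rewrite setTD setCK.
Qed.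

(** A zero integral of a function positive on the half-line would make the half-line a null set,
    whereas it has probability 1. *)
Lemma inv_moment_gt0 (k : nat) :
  Pi.-integrable setT (fun t : R => (t ^- k)%:E) -> 0 < inv_moment Pi k.
Proof.
move=> ik; have := integral_inv_moment ik; set D := `]0%R, +oo[%classic => IE.
have mD : measurable (D : set (measurableTypeR R)) by exact: measurable_itv.
have D0 (t : R) : D t -> 0 < t ^- k.
  by rewrite /D/= in_itv/= andbT => t0; rewrite invr_gt0 exprn_gt0.
have mf : measurable_fun D (fun t : R => (t ^- k)%:E).
  by apply: measurable_funTS; exact: (measurable_int _ ik).
rewrite lt_neqAle; apply/andP; split; last first.
  by rewrite -lee_fin -IE; apply: integral_ge0 => t /D0 /ltW; rewrite lee_fin.
apply/eqP => /esym M0; rewrite M0 in IE.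
have /(ae_eq_integral_abs Pi mD mf)[N [mN N0 subN]] :
    (\int[Pi]_(x in D) `| (x ^- k)%:E |)%E = 0%E.
  apply: etrans IE; apply: eq_integral => t /[!inE] /D0 t0.
  by rewrite gee0_abs// lee_fin ltW.
have DN : D `<=` N.
  move=> t Dt; apply: subN => /= /(_ Dt) [] t0.
  by have := D0 _ Dt; rewrite t0 ltxx.
have : (Pi D <= Pi N)%E by apply: le_measure => //; rewrite inE.
by rewrite N0 /D -pos_itv [X in (X <= _)%E]Pi_pos lee_fin ler10.
Qed.

End inverse_moments.

(* Expanding squares, the loss decreases by
   (phi - psi) S ((phi + psi) S - 2) when psi < phi. *)
Lemma L1_min_bound (R : realType) (phi psi S v : R) : 0 <= psi ->
  L1 (Num.min phi psi * S) v + 2 * Num.max (phi - psi) 0 * psi * (S / v) ^+ 2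
  <= L1 (phi * S) v + 2 * Num.max (phi - psi) 0 * `|S / v|.
Proof.
move=> psi0; rewrite /L1 -!mulrA; set s := S / v.
have [le|lt] := leP phi psi.
  rewrite (max_idPr _); last by rewrite subr_le0.
  by rewrite !mul0r !mulr0.
rewrite (max_idPl _); last by rewrite subr_ge0 ltW.
have := ler_norm s; have := normr_ge0 s; set b := `|s| => b0 sb.
rewrite -subr_ge0.
have -> : (phi * s - 1) ^+ 2 + 2 * ((phi - psi) * b) -
   ((psi * s - 1) ^+ 2 + 2 * ((phi - psi) * (psi * s ^+ 2))) =
   (phi - psi) * ((phi - psi) * s ^+ 2 + 2 * (b - s)) by ring.
apply: mulr_ge0; first by rewrite subr_ge0 ltW.
apply: addr_ge0; first by rewrite mulr_ge0 ?sqr_ge0// subr_ge0 ltW.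
by rewrite mulr_ge0// subr_ge0.
Qed.

(** After bounding the excess by [phi], put u = phi S / v: for u >= 0 the gap 3 + (u - 1)^2 - 2 u is
    (u - 2)^2, whence the constant 3, and for u < 0 the gap is u^2 + 4. A finite risk thus dominates
    the excess term. *)
Lemma excess_le_L1 (R : realType) (phi psi S v : R) : 0 <= phi -> 0 <= psi ->
  2 * Num.max (phi - psi) 0 * `|S / v| <= 3 + L1 (phi * S) v.
Proof.
move=> phi0 psi0; rewrite /L1 -!mulrA; set s := S / v.
have le1 : 2 * (Num.max (phi - psi) 0 * `|s|) <= 2 * (phi * `|s|).
  rewrite ler_wpM2l// ler_wpM2r// ge_max phi0 andbT.
  by rewrite lerBlDr lerDl.
apply: (le_trans le1).
rewrite -[phi in leLHS]ger0_norm// -normrM; set u := phi * s.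
have [u0|u0] := ger0P u; last first.
  by have := sqr_ge0 (u - 1); nra.
by have := sqr_ge0 (u - 2); nra.
Qed.

(** * The risk comparison *)

Theorem theorem2p1 (R : realType) (p q m1 m2 : nat)
  (p_gt0 : (0 < p)%N) (q_gt0 : (0 < q)%N)
  (m1_gt0 : (0 < m1)%N) (m2_gt0 : (0 < m2)%N)
  (Pi : probability (measurableTypeR R) R)
  (Pi_pos : Pi [set t : R | 0 < t] = 1%E)
  (moment1 : Pi.-integrable setT (fun t : R => (t ^- 1)%:E))
  (moment2 : Pi.-integrable setT (fun t : R => (t ^- 2)%:E))
  (phi1 : R -> R)
  (phi1_measurable : measurable_fun [set z : R | 0 < z] phi1)
  (phi1_pos : forall z : R, 0 < z -> 0 < phi1 z)
  (theta1 : p.-tuple R) (theta2 : q.-tuple R) (sigma1 sigma2 : R)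
  (sigma1_gt0 : 0 < sigma1) (sigma2_gt0 : 0 < sigma2)
  (sigma12 : sigma1 <= sigma2)
  (d : measure_display) (T : measurableType d) (P : probability T R)
  (tau : {RV P >-> R}) (X1 : {RV P >-> p.-tuple R}) (S1 : {RV P >-> R})
  (X2 : {RV P >-> q.-tuple R}) (S2 : {RV P >-> R})
  (model : normal_scale_mixture Pi m1 m2 theta1 theta2 sigma1 sigma2
             tau X1 S1 X2 S2)
  (phi1_exceeds :
     (0 < P [set w | let z := S2 w / S1 w in
                     0 < z /\ phiQ11 Pi m1 m2 z < phi1 z]%R)%E) :
  (risk P (sigma1 ^+ 2)
     (ratio_estimator (fun z => Num.min (phi1 z) (phiQ11 Pi m1 m2 z)) S1 S2)
   <= risk P (sigma1 ^+ 2) (ratio_estimator phi1 S1 S2))%E.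

Proof.
case: model => _ law.
have mS1 : measurable_fun setT S1 by exact: measurable_funPT.
have mS2 : measurable_fun setT S2 by exact: measurable_funPT.
pose a1 := sigma1 ^+ 2; pose a2 := sigma2 ^+ 2; pose rho := a2 / a1.
have a1_gt0 : 0 < a1 by rewrite exprn_gt0.
have a2_gt0 : 0 < a2 by rewrite exprn_gt0.
have rho1 : 1 <= rho by rewrite ler_pdivlMr// mul1r lerXn2r// nnegrE ltW.
pose f1 := @chi2_pdf R m1; pose f2 := @chi2_pdf R m2.
(* Full events for [tau], [X1] and [X2] turn the normal factors into 1, leaving the joint law of
   ([S1], [S2]). *)
have lawE (C1 C2 : set R) : measurable C1 -> measurable C2 ->
    (P [set w | C1 (S1 w) /\ C2 (S2 w)] = \int[Pi]_(t in `]0%R, +oo[)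
     ((\int[lebesgue_measure]_(x in (fun x => a1 / t * x)%R @^-1` C1) (f1 x)%:E) *
      (\int[lebesgue_measure]_(y in (fun y => a2 / t * y)%R @^-1` C2) (f2 y)%:E)))%E.
  move=> mC1 mC2.
  have := law setT setT C1 setT C2 measurableT measurableT mC1 measurableT mC2.
  rewrite setTI.
  have -> : [set w | [/\ setT (tau w), setT (X1 w), C1 (S1 w), setT (X2 w) & C2 (S2 w)]]
      = [set w | C1 (S1 w) /\ C2 (S2 w)].
    by apply/seteqP; split => w /= [].
  move=> ->; apply: eq_integral => t _.
  by rewrite !probability_setT mul1e mule1.
pose M1 := inv_moment Pi 1; pose M2 := inv_moment Pi 2.
have M1_gt0 : 0 < M1 by exact: inv_moment_gt0.
have M2_gt0 : 0 < M2 by exact: inv_moment_gt0.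
pose m : R := (m1 + m2 + 2)%:R.
have m_gt0 : 0 < m by rewrite ltr0n addn_gt0 orbT.
pose c := M1 / (m * M2).
have c0 : 0 <= c by rewrite divr_ge0 ?mulr_ge0 ?ltW.
pose psi := phiQ11 Pi m1 m2.
have psiE z : psi z = c * (1 + z) by rewrite /psi /phiQ11 /c -/M1 -/M2 -/m; ring.
have psi0 z : 0 < z -> 0 <= psi z.
  by move=> z0; rewrite psiE mulr_ge0// addr_ge0// ltW.
pose D : set R := `]0, +oo[%classic.
have DE : D = [set z | 0 < z].
  by apply/seteqP; split => z; rewrite /D/= in_itv/= andbT.
have patchD (phi : R -> R) u : (phi \_ D) u = if 0 < u then phi u else 0.
  by rewrite patchE /D mem_setE in_itv/= andbT.
have mD : measurable D by exact: measurable_itv.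
have mpsi : measurable_fun setT psi.
  rewrite (_ : psi = (fun z => c * (1 + z))); last exact/funext.
  by apply: measurable_funM => //; exact: measurable_funD.
have mphi : measurable_fun D phi1 by rewrite DE.
(* Cut to 0 off the half-line, as in [ratio_estimator]: where S2 / S1 <= 0 both estimators and [g]
   are 0, so the bounds below hold at every point and no null set has to be discarded. *)
pose g := (fun z => 2 * Num.max (phi1 z - psi z) 0) \_ D.
have gD z : 0 < z -> g z = 2 * Num.max (phi1 z - psi z) 0.
  by move=> z0; rewrite /g patchD z0.
have gN z : z <= 0 -> g z = 0.
  by move=> z0; rewrite /g patchD ltNge z0.
have g0 z : 0 <= g z.
  have [z0|z0] := leP z 0; first by rewrite gN.
  by rewrite gD// mulr_ge0// le_max lexx orbT.
have mg : measurable_fun setT g.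
  apply/(measurable_restrictT _ mD).
  apply: measurable_funM => //; apply: measurable_maxr => //.
  by apply: measurable_funB => //; exact: measurable_funTS.
pose mR := measurableTypeR R.
have p1 : measurable_fun [set: mR * mR] fst := @measurable_fst _ _ mR mR.
have p2 : measurable_fun [set: mR * mR] snd := @measurable_snd _ _ mR mR.
(* [h1] and [h2] are the two weighted terms as functions of the observed pair. Substituting S1 = a1
   x / t and S2 = a2 y / t turns the ratio into rho y / x and S1 / a1 into x / t; [H1] and [H2] are
   what remains after removing the powers of t. *)
pose h1 (z : mR * mR) : R := g (z.2 / z.1) * `|z.1 / a1|.
pose h2 (z : mR * mR) : R := g (z.2 / z.1) * psi (z.2 / z.1) * (z.1 / a1) ^+ 2.
pose H1 (z : mR * mR) : R := g (rho * (z.2 / z.1)) * `|z.1|.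
pose H2 (z : mR * mR) : R :=
  g (rho * (z.2 / z.1)) * psi (rho * (z.2 / z.1)) * z.1 ^+ 2.
have gpsi0 z : 0 <= g z * psi z.
  have [z0|z0] := leP z 0; first by rewrite gN// mul0r.
  by rewrite mulr_ge0// psi0.
have h10 z : 0 <= h1 z by rewrite mulr_ge0.
have h20 z : 0 <= h2 z by rewrite mulr_ge0 ?sqr_ge0.
have H10 z : 0 <= H1 z by rewrite mulr_ge0.
have H20 z : 0 <= H2 z by rewrite mulr_ge0 ?sqr_ge0.
have mz : measurable_fun [set: mR * mR] (fun z => z.2 / z.1 : R).
  exact: measurable_fun_div.
have mrz : measurable_fun [set: mR * mR] (fun z => rho * (z.2 / z.1) : R).
  exact: measurable_funM.
have mza : measurable_fun [set: mR * mR] (fun z => z.1 / a1 : R).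
  exact: measurable_funM.
have mh1 : measurable_fun setT h1.
  apply: measurable_funM; first exact: (measurableT_comp mg mz).
  exact: (measurableT_comp (@normr_measurable R setT) mza).
have mh2 : measurable_fun setT h2.
  apply: measurable_funM; last exact: measurable_funX.
  apply: measurable_funM; first exact: (measurableT_comp mg mz).
  exact: (measurableT_comp mpsi mz).
have mH1 : measurable_fun setT H1.
  apply: measurable_funM; first exact: (measurableT_comp mg mrz).
  exact: (measurableT_comp (@normr_measurable R setT) p1).
have mH2 : measurable_fun setT H2.
  apply: measurable_funM; last exact: measurable_funX.
  apply: measurable_funM; first exact: (measurableT_comp mg mrz).
  exact: (measurableT_comp mpsi mrz).
have ratioE (t x y : R) : 0 < t ->
    (a2 / t * y) / (a1 / t * x) = rho * (y / x).
  move=> t0; rewrite [(a1 / t * x)^-1]invfM [(a1 / t)^-1]invfM invrK /rho.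
  transitivity (a2 / a1 * (y / x) * (t / t)); first by ring.
  by rewrite divff ?mulr1// gt_eqF.
have scaleE (t x : R) : a1 / t * x / a1 = t^-1 * x.
  transitivity (t^-1 * x * (a1 / a1)); first by ring.
  by rewrite divff ?mulr1// gt_eqF.
have h1H (t x y : R) : 0 < t ->
    h1 (a1 / t * x, a2 / t * y) = t ^- 1 * H1 (x, y).
  move=> t0; rewrite /h1 /H1 /= ratioE// scaleE normrM gtr0_norm ?invr_gt0//.
  by rewrite mulrCA.
have h2H (t x y : R) : 0 < t ->
    h2 (a1 / t * x, a2 / t * y) = t ^- 2 * H2 (x, y).
  move=> t0; rewrite /h2 /H2 /= ratioE// scaleE exprMn exprVn.
  by rewrite mulrCA.
have [f10 f20] := (chi2_pdf_ge0 m1 (R := R), chi2_pdf_ge0 m2 (R := R)).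
have [mf1 mf2] := (@measurable_chi2_pdf R m1, @measurable_chi2_pdf R m2).
have E1 := integral_scale_mixture_homogeneous mS1 mS2 f10 f20 mf1 mf2 lawE
  h10 mh1 H10 mH1 h1H.
have E2 := integral_scale_mixture_homogeneous mS1 mS2 f10 f20 mf1 mf2 lawE
  h20 mh2 H20 mH2 h2H.
rewrite (integral_inv_moment Pi_pos moment1) -/M1 in E1.
rewrite (integral_inv_moment Pi_pos moment2) -/M2 in E2.
(* The chi-square inequality is applied to [c * g]: on the right c (1 + z) becomes [psi], and the
   left side carries m c, where M2 m c = M1. The moment ratio in [phiQ11] is exactly what balances
   the factors [M1] and [M2] of [E1] and [E2]. *)
have E12 : (\int[P]_w (h1 (S1 w, S2 w))%:E <= \int[P]_w (h2 (S1 w, S2 w))%:E)%E.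
  have mcg : measurable_fun setT (fun z => c * g z) by exact: measurable_funM.
  have cg0 z : 0 <= c * g z by rewrite mulr_ge0.
  have cgN z : z <= 0 -> c * g z = 0 by move=> z0; rewrite gN// mulr0.
  have := chi2_ratio_moment m1_gt0 m2_gt0 rho1 mcg cg0 cgN.
  pose F (z : mR * mR) : \bar R := (H1 z * (f1 z.1 * f2 z.2))%:E.
  have F0 z : (0 <= F z)%E by rewrite lee_fin mulr_ge0// mulr_ge0// ?f10 ?f20.
  have mF : measurable_fun setT F.
    apply/measurable_EFinP; apply: measurable_funM => //; apply: measurable_funM.
      exact: (measurableT_comp mf1 p1).
    exact: (measurableT_comp mf2 p2).
  have mc0 : 0 <= m * c by rewrite mulr_ge0// ltW.
  have -> : (\int[lebesgue_measure]_x \int[lebesgue_measure]_y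
      ((m1 + m2 + 2)%:R * (c * g (rho * (y / x)) * `|x|)
        * (chi2_pdf m1 x * chi2_pdf m2 y))%:E =
      (m * c)%:E * \int[lebesgue_measure]_x \int[lebesgue_measure]_y F (x, y))%E.
    rewrite -(ge0_iterated_integralZl mc0 F0 mF).
    apply: eq_integral => x _; apply: eq_integral => y _.
    by rewrite /F /H1 -EFinM; congr (_%:E); rewrite /= -/m -/f1 -/f2; ring.
  have -> : (\int[lebesgue_measure]_x \int[lebesgue_measure]_y
      (c * g (rho * (y / x)) * (1 + rho * (y / x)) * x ^+ 2
        * (chi2_pdf m1 x * chi2_pdf m2 y))%:E =
      \int[lebesgue_measure]_x \int[lebesgue_measure]_y
        (H2 (x, y) * (f1 x * f2 y))%:E)%E.
    apply: eq_integral => x _; apply: eq_integral => y _.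
    by congr (_%:E); rewrite /H2 /= psiE -/f1 -/f2; ring.
  rewrite E1 E2 => le.
  have -> : M1%:E = (M2%:E * (m * c)%:E)%E.
    by rewrite -EFinM; congr (_%:E); rewrite /c; field; rewrite !gt_eqF.
  by rewrite -muleA; apply: lee_wpmul2l => //; rewrite lee_fin ltW.
pose z w := S2 w / S1 w.
have mzw : measurable_fun setT z by exact: measurable_fun_div.
have mL (phi : R -> R) : measurable_fun D phi ->
    measurable_fun setT (fun w => (L1 (ratio_estimator phi S1 S2 w) a1)%:E).
  move=> mp; apply/measurable_EFinP; apply: measurable_funX.
  apply: measurable_funB => //; apply: measurable_funM => //.
  apply: measurable_funM => //.
  exact: (measurableT_comp ((measurable_restrictT _ mD).1 mp) mzw).
have mS : measurable_fun setT (fun w => (S1 w, S2 w) : mR * mR).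
  exact: measurable_fun_pair.
have mh1S : measurable_fun setT (fun w => (h1 (S1 w, S2 w))%:E).
  by apply/measurable_EFinP; exact: (measurableT_comp mh1 mS).
have mh2S : measurable_fun setT (fun w => (h2 (S1 w, S2 w))%:E).
  by apply/measurable_EFinP; exact: (measurableT_comp mh2 mS).
have mmin : measurable_fun D (fun z => Num.min (phi1 z) (psi z)).
  by apply: measurable_minr => //; exact: measurable_funTS.
rewrite /risk unlock -/a1.
set L0 := fun w => (L1 (ratio_estimator _ S1 S2 w) a1)%:E.
set Lphi := fun w => (L1 (ratio_estimator phi1 S1 S2 w) a1)%:E.
have mL0 : measurable_fun setT L0 by exact: mL.
have mLphi : measurable_fun setT Lphi by exact: mL.
have L00 w : (0 <= L0 w)%E by rewrite lee_fin sqr_ge0.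
have Lphi0 w : (0 <= Lphi w)%E by rewrite lee_fin sqr_ge0.
have bound w : (L0 w + (h2 (S1 w, S2 w))%:E <= Lphi w + (h1 (S1 w, S2 w))%:E)%E.
  rewrite -!EFinD lee_fin /ratio_estimator /h1 /h2 /= -/D !patchD -/(z w).
  case: ifPn => [z0|]; last by rewrite -leNgt => z0; rewrite gN// !mul0r.
  by rewrite gD//; apply: L1_min_bound; exact: psi0.
have bound1 w : ((h1 (S1 w, S2 w))%:E <= 3%:E + Lphi w)%E.
  rewrite -EFinD lee_fin /ratio_estimator /h1 /= -/D patchD -/(z w).
  case: ifPn => [z0|]; last first.
    by rewrite -leNgt => z0; rewrite gN// mul0r addr_ge0 ?sqr_ge0.
  rewrite gD//; apply: excess_le_L1; last exact: psi0.
  exact/ltW/phi1_pos.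
(* Past this case split the risk of [phi1] is finite, hence so is the integral of [h1], which may be
   added to both sides and cancelled. *)
have [->|Rfin] := eqVneq (\int[P]_w Lphi w)%E +oo%E; first exact: leey.
have h1_fin : (\int[P]_w (h1 (S1 w, S2 w))%:E)%E \is a fin_num.
  rewrite ge0_fin_numE; last first.
    by apply: integral_ge0 => w _; rewrite lee_fin.
  apply: (@le_lt_trans _ _ (\int[P]_w (3%:E + Lphi w))%E).
    apply: ge0_le_integral => //; first by move=> w _; rewrite lee_fin.
    exact: emeasurable_funD.
  rewrite ge0_integralD//.
  rewrite integral_cst// lte_add_pinfty//.
    by rewrite lte_mul_pinfty// -ge0_fin_numE// fin_num_measure.
  by rewrite lt_neqAle Rfin leey.
rewrite -(leeD2rE _ _ h1_fin).
(* [E12] replaces [h1] by [h2] next to [L0]; integrating [bound] then leads to [Lphi] and [h1]. *)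
apply: (@le_trans _ _ (\int[P]_w L0 w + \int[P]_w (h2 (S1 w, S2 w))%:E)%E).
  exact: leeD2l.
have h1S0 w : (0 <= (h1 (S1 w, S2 w))%:E)%E by rewrite lee_fin.
have h2S0 w : (0 <= (h2 (S1 w, S2 w))%:E)%E by rewrite lee_fin.
rewrite -!ge0_integralD//; last by move=> w _; exact: Lphi0.
apply: ge0_le_integral => //.
- by move=> w _; rewrite adde_ge0.
- exact: emeasurable_funD.
- exact: emeasurable_funD.
Qed.
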